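(* Let $\hat x:\mathrm{M}^2\to\mathbb{S}^3$ be an immersed surface with unit normal ${\bf n}$, let $\lambda:\mathbb{S}^3\to\mathbb{R}^+$ be a positive smooth function, and let $\lambda^2g_0$ be the corresponding metric in the conformal class $[g_0]$ of the round metric on $\mathbb{S}^3$. Then the conformal Gauss map $\xi$ of $\hat x$ satisfies $$\xi = H_\lambda\, y_\lambda+\overset{\rightarrow}{\bf n}_\lambda ,$$ where $H_\lambda$ is the mean curvature of $\hat x$ in $(\mathbb{S}^3,\lambda^2g_0)$ and $\overset{\rightarrow}{\bf n}_\lambda$ is the unit normal to the surface $y_\lambda$ inside the 3-sphere $\mathbb{S}^3_\lambda\subset\mathbb{N}^4_+$.
   Context: $\mathbb{R}^{1,4}=\{(t,x):t\in\mathbb{R},x\in\mathbb{R}^4\}$ is Minkowski spacetime with $\langle(t,x),(s,y)\rangle=-st+x\cdot y$; $\mathbb{N}^4_+=\{(t,x):-t^2+|x|^2=0,\ t>0\}$ is the positive light cone; $\mathbb{S}^{1,3}=\{(t,x):-t^2+|x|^2=1\}$ is de Sitter spacetime. $\mathbb{S}^3\subset\mathbb{R}^4$ is the unit sphere with round metric $g_0$. All maps are smooth. For an immersed surface $\hat x:\mathrm{M}^2\to\mathbb{S}^3\subset\mathbb{R}^4$ with unit normal ${\bf n}:\mathrm{M}^2\to\mathbb{R}^4$ (normal to the surface, tangent to $\mathbb{S}^3$), the first and second fundamental forms are $I=\langle d\hat x,d\hat x\rangle$, $II=-\langle d\hat x,d{\bf n}\rangle$, and the mean curvature is $H=\frac12\mathrm{tr}_I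 II$. Put $y=(1,\hat x):\mathrm{M}^2\to\mathbb{N}^4_+$ and $\overset{\rightarrow}{\bf n}=(0,{\bf n})$. The conformal Gauss map of $\hat x$ is $$\xi=H\,y+\overset{\rightarrow}{\bf n}:\mathrm{M}^2\to\mathbb{S}^{1,3}\subset\mathbb{R}^{1,4}.$$ For a positive function $\lambda$ on $\mathbb{S}^3$, $\mathbb{S}^3_\lambda\subset\mathbb{N}^4_+$ is the image of $x\mapsto\lambda(x)(1,x)$, $x\in\mathbb{S}^3$; the metric it inherits from $\mathbb{R}^{1,4}$ is $\lambda^2g_0$, so it is a realization of $(\mathbb{S}^3,\lambda^2g_0)$. With $\hat\lambda=\lambda\circ\hat x$, $y_\lambda=\hat\lambda(1,\hat x):\mathrm{M}^2\to\mathbb{S}^3_\lambda$ is the surface corresponding to $\hat x$. The unit normal $\overset{\rightarrow}{\bf n}_\lambda$ to $y_\lambda$ in $\mathbb{S}^3_\lambda$ is the one pointing to the same side as ${\bf n}$ (i.e. the positive multiple of the image of ${\bf n}$ under the differential of $x\mapsto\lambda(x)(1,x)$). $H_\lambda$ is half the trace, with respect to the metric $I_\lambda$ induced by $\lambda^2g_0$, of the second fundamental form $II_\lambda$ of $\hat x$ in $(\mathbb{S}^3,\lambda^2g_0)$ with respect to the unit normal $\lambda^{-1}{\bf n}$, with the same sign convention as for $II$. *)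

(* Defs.v *)
From HB Require Import structures.
From mathcomp Require Import all_boot all_order all_algebra.
From mathcomp Require Import all_classical all_reals all_analysis.

Set Implicit Arguments.
Unset Strict Implicit.
Unset Printing Implicit Defensive.

Import Order.TTheory GRing.Theory Num.Theory.
Import numFieldNormedType.Exports.

Local Open Scope classical_set_scope.
Local Open Scope ring_scope.

Fixpoint Ck_on (R : realType) (V W : normedModType R) (k : nat)
    (U : set V) (f : V -> W) : Prop :=
  match k with
  | 0 => forall x, U x -> {for x, continuous f}
  | k'.+1 => (forall x, U x -> differentiable f x) /\
             (forall v : V, Ck_on k' U ('D_v f))
  end.

(* Only used for open U. *)
Definition smooth_on (R : realType) (V W : normedModType R)
    (U : set V) (f : V -> W) : Prop := forall k, Ck_on k U f.

Definition dotv (R : realType) (n : nat) (u v : 'rV[R]_n) : R :=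
  \sum_i u 0 i * v 0 i.

Definition basis_vec (R : realType) (n : nat) (i : 'I_n) : 'rV[R]_n :=
  delta_mx 0 i.

(* A smooth surface: a Hausdorff, second countable space with a smooth
   two-dimensional atlas.  The atlas is indexed by the points of the space:
   the chart of index p, [chart p : dom p -> 'rV_2] with inverse [param p], is
   some chart around p. *)
Record surface (R : realType) := Surface {
  surface_sort :> topologicalType;
  surface_hausdorff : hausdorff_space surface_sort;
  surface_countable : @second_countable surface_sort;
  dom : surface_sort -> set surface_sort;
  chart : surface_sort -> surface_sort -> 'rV[R]_2;
  param : surface_sort -> 'rV[R]_2 -> surface_sort;
  dom_open : forall p, open (dom p);
  dom_mem : forall p, dom p p;
  cod_open : forall p, open (chart p @` dom p);
  chartK : forall p x, dom p x -> param p (chart p x) = x;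
  chart_continuous : forall p x, dom p x -> {for x, continuous (chart p)};
  param_continuous : forall p z, (chart p @` dom p) z ->
    {for z, continuous (param p)};
  chart_compatible : forall p q,
    smooth_on (chart p @` (dom p `&` dom q)) (chart q \o param p)
}.

Section SurfaceCalculus.
Variables (R : realType) (M : surface R).

Definition smooth_map (W : normedModType R) (f : M -> W) : Prop :=
  forall p, smooth_on (chart p @` dom p) (f \o param p).

(* The differential of f at p; the tangent plane of M at p is identified with
   'rV_2 by means of the chart of index p. *)
Definition dmap (W : normedModType R) (f : M -> W) (p : M) (v : 'rV[R]_2) : W :=
  'D_v (f \o param p) (chart p p).

(* The trace of the bilinear form B with respect to the metric G, both being
   given by their matrices in the same basis. *)
Definition trace_wrt (G B : 'M[R]_2) : R := \tr (invmx G *m B).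

End SurfaceCalculus.

Section RoundSphere.
Variable R : realType.

Definition S3 : set 'rV[R]_4 := [set x | dotv x x = 1].

Variable M : surface R.
Variables (x n : M -> 'rV[R]_4).

Definition immersed_in_S3 : Prop :=
  [/\ smooth_map x,
      forall p, S3 (x p) &
      forall p v, dmap x p v = 0 -> v = 0].

Definition unit_normal : Prop :=
  [/\ smooth_map n,
      forall p, dotv (n p) (n p) = 1,
      forall p, dotv (n p) (x p) = 0 &
      forall p v, dotv (n p) (dmap x p v) = 0].

Definition fundI (p : M) : 'M[R]_2 := \matrix_(a, b)
  dotv (dmap x p (basis_vec R a)) (dmap x p (basis_vec R b)).

Definition fundII (p : M) : 'M[R]_2 := \matrix_(a, b)
  - dotv (dmap x p (basis_vec R a)) (dmap n p (basis_vec R b)).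

Definition mean_curvature (p : M) : R := 2^-1 * trace_wrt (fundI p) (fundII p).

End RoundSphere.

(* Minkowski spacetime R^{1,4}, as pairs (t, x). *)
Notation mink_space R := (R^o * 'rV[R]_4)%type.

Definition mink (R : realType) (u v : mink_space R) : R :=
  - (u.1 * v.1) + dotv u.2 v.2.

Definition conformal_gauss_map (R : realType) (M : surface R)
    (x n : M -> 'rV[R]_4) (p : M) : mink_space R :=
  mean_curvature x n p *: ((1, x p) : mink_space R) + (0, n p).

(* A smooth atlas of the unit sphere S^3 as an embedded submanifold of R^4,
   indexed by the points of the sphere: for q in S^3, [spar q] is a smooth
   parametrization of a neighbourhood of q in S^3 by the open set [sdom q] of
   R^3, and its inverse is the restriction to S^3 of the smooth map [scoord q],
   defined on the open set [snbhd q] of R^4. *)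
Record sphere_atlas (R : realType) := SphereAtlas {
  sdom : 'rV[R]_4 -> set 'rV[R]_3;
  snbhd : 'rV[R]_4 -> set 'rV[R]_4;
  spar : 'rV[R]_4 -> 'rV[R]_3 -> 'rV[R]_4;
  scoord : 'rV[R]_4 -> 'rV[R]_4 -> 'rV[R]_3;
  sdom_open : forall q, S3 q -> open (sdom q);
  snbhd_open : forall q, S3 q -> open (snbhd q);
  snbhd_mem : forall q, S3 q -> snbhd q q;
  spar_smooth : forall q, S3 q -> smooth_on (sdom q) (spar q);
  scoord_smooth : forall q, S3 q -> smooth_on (snbhd q) (scoord q);
  sparP : forall q z, S3 q -> sdom q z ->
    [/\ S3 (spar q z), snbhd q (spar q z) & scoord q (spar q z) = z];
  scoordP : forall q y, S3 q -> snbhd q y -> S3 y ->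
    sdom q (scoord q y) /\ spar q (scoord q y) = y
}.

Section SphereCalculus.
Variables (R : realType) (A : sphere_atlas R).

Definition smooth_on_S3 (W : normedModType R) (f : 'rV[R]_4 -> W) : Prop :=
  forall q, S3 q -> smooth_on (sdom A q) (f \o spar A q).

(* The differential at q in S^3, in the tangent direction v, of a function on
   S^3; the values of f outside S^3 play no role. *)
Definition dS3 (W : normedModType R) (f : 'rV[R]_4 -> W) (q v : 'rV[R]_4) : W :=
  'D_('D_v (scoord A q) q) (f \o spar A q) (scoord A q q).

End SphereCalculus.

Section Riemannian.
Variables (R : realType) (g : 'rV[R]_3 -> 'M[R]_3).

Definition pderiv (f : 'rV[R]_3 -> R) (i : 'I_3) (z : 'rV[R]_3) : R :=
  'D_(basis_vec R i) (f : 'rV[R]_3 -> R^o) z.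

(* The Christoffel symbol Gamma^k_(ij) of the Levi-Civita connection of the
   metric g, given in coordinates. *)
Definition christoffel (z : 'rV[R]_3) (k i j : 'I_3) : R :=
  2^-1 * \sum_l invmx (g z) k l *
    (pderiv (fun w => g w j l) i z + pderiv (fun w => g w i l) j z
     - pderiv (fun w => g w i j) l z).

Variables (M : surface R) (u X : M -> 'rV[R]_3) (p : M).

(* The Levi-Civita covariant derivative at p, in the direction v, of the vector
   field X along the map u. *)
Definition covariant_derivative (v : 'rV[R]_2) : 'rV[R]_3 :=
  \row_k (dmap X p v 0 k +
    \sum_i \sum_j christoffel (u p) k i j * dmap u p v 0 i * X p 0 j).

Definition gform (z a b : 'rV[R]_3) : R :=
  \sum_i \sum_j g z i j * a 0 i * b 0 j.

Definition induced_metric : 'M[R]_2 := \matrix_(a, b)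
  gform (u p) (dmap u p (basis_vec R a)) (dmap u p (basis_vec R b)).

(* Here X is the unit normal along u. *)
Definition second_form : 'M[R]_2 := \matrix_(a, b)
  - gform (u p) (dmap u p (basis_vec R a))
                (covariant_derivative (basis_vec R b)).

End Riemannian.

Section ConformalSphere.
Variables (R : realType) (A : sphere_atlas R) (lambda : 'rV[R]_4 -> R).

(* The metric lambda^2 g_0 of S^3 in the coordinates of index q. *)
Definition conformal_metric (q : 'rV[R]_4) (z : 'rV[R]_3) : 'M[R]_3 :=
  \matrix_(i, j) (lambda (spar A q z) ^+ 2 *
    dotv ('D_(basis_vec R i) (spar A q) z) ('D_(basis_vec R j) (spar A q) z)).

(* The map whose image is the sphere S^3_lambda of the light cone. *)
Definition cone_embedding (y : 'rV[R]_4) : mink_space R :=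
  lambda y *: ((1, y) : mink_space R).

Variables (M : surface R) (x n : M -> 'rV[R]_4).

Definition cone_surface (p : M) : mink_space R := cone_embedding (x p).

(* The unit vector which is a positive multiple of the image of n under the
   differential of [cone_embedding]. *)
Definition cone_normal (p : M) : mink_space R :=
  let w := dS3 A cone_embedding (x p) (n p) in
  (Num.sqrt (mink w w))^-1 *: w.

(* The surface x and its lambda^2 g_0-unit normal lambda^-1 n, in the
   coordinates of S^3 of index q. *)
Definition surface_coord (q : 'rV[R]_4) (m : M) : 'rV[R]_3 := scoord A q (x m).

Definition normal_coord (q : 'rV[R]_4) (m : M) : 'rV[R]_3 :=
  'D_((lambda (x m))^-1 *: n m) (scoord A q) (x m).

(* The mean curvature of x in (S^3, lambda^2 g_0). *)
Definition conformal_mean_curvature (p : M) : R :=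
  let g := conformal_metric (x p) in
  let u := surface_coord (x p) in
  let X := normal_coord (x p) in
  2^-1 * trace_wrt (induced_metric g u p) (second_form g u X p).

End ConformalSphere.

(* Main.v *)
(* Let phi be a chart of S^3, L = lambda o phi and g = L^2 <d phi, d phi> the metric
   in coordinates.  The Koszul formula gives
     g(U, Gamma(V, X)) = L^2 <phi_U, phi_VX>
       + L (L_V <phi_U, phi_X> + L_X <phi_U, phi_V> - L_U <phi_V, phi_X>),
   where the symmetry of the second derivatives of phi is used.  For U, V tangent
   to the surface and d phi(X) = lambda^-1 n, the first and last terms in L vanish;
   differentiating d phi(X) = lambda^-1 n along the surface then gives
   II_lambda = lambda II - d lambda(n) I, hence
   H_lambda = lambda^-1 H - lambda^-2 d lambda(n).  On the other hand the normal of
   the cone surface is lambda^-1 d lambda(n) y + (0, n), and the two terms in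
   d lambda(n) cancel in H_lambda y_lambda + n_lambda. *)
Require Import Defs.
From mathcomp Require Import all_boot all_order all_algebra.
From mathcomp Require Import all_classical all_reals all_analysis.
From mathcomp Require Import ring.
Import Order.TTheory GRing.Theory Num.Theory.
Import numFieldNormedType.Exports.
Local Open Scope ring_scope.

Set Implicit Arguments.
Unset Strict Implicit.
Unset Printing Implicit Defensive.
Local Open Scope classical_set_scope.

(** * Rules for directional derivatives *)

Section DirectionalDerivatives.
Variable R : realType.
Implicit Types V W : normedModType R.

(** The two difference quotients are the same function of [h]. This turns derivatives on [V] into
    derivatives in one real variable, to which the mean value theorem applies. *)
Lemma is_derive_line V W (f : V -> W) (c v : V) (t : R) (df : W) :
  is_derive (t *: v + c) v f df -> is_derive t 1 (fun s => f (s *: v + c)) df.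
Proof.
pose g1 := fun h : R =>
  h^-1 *: (((fun s => f (s *: v + c)) \o shift t) (h *: 1) - f (t *: v + c)).
pose g2 := fun h : R => h^-1 *: ((f \o shift (t *: v + c)) (h *: v) - f (t *: v + c)).
have gE : g1 = g2.
  by apply/funext => h; rewrite /g1 /g2 /= [h *: 1]mulr1 scalerDl addrA.
case=> fd fE; split; first by rewrite /derivable -/g1 gE.
by rewrite /derive -/g1 gE.
Qed.

Lemma is_derive_comp V V' W (f : V -> V') (g : V' -> W) (a v : V) :
  differentiable f a -> differentiable g (f a) ->
  is_derive a v (g \o f) ('D_('D_v f a) g (f a)).
Proof.
move=> df dg; have dgf := differentiable_comp df dg.
split; first exact: diff_derivable.
by rewrite deriveE// diff_comp// !deriveE.
Qed.

Lemma is_derive_coord V m (f : V -> 'rV[R]_m) (a v : V) (df : 'rV[R]_m) (j : 'I_m) :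
  is_derive a v f df -> is_derive a v (fun y => f y 0 j) (df 0 j).
Proof.
case=> fd <-; split; first exact: (derivable_mxP _ _ _).1.
by rewrite derive_mx// mxE.
Qed.

Lemma is_derive_row V m (f : V -> 'rV[R]_m) (a v : V) (df : 'rV[R]_m) :
  (forall j, is_derive a v (fun y => f y 0 j) (df 0 j)) -> is_derive a v f df.
Proof.
move=> fd.
have fdv : derivable f a v.
  by apply/derivable_mxP => i j; rewrite ord1; have [] := fd j.
split => //; rewrite derive_mx//; apply/rowP => j; rewrite mxE.
by have [] := fd j.
Qed.

Lemma is_derive_mul V (f g : V -> R) (a v : V) (df dg : R) :
  is_derive a v f df -> is_derive a v g dg ->
  is_derive a v (fun y => f y * g y) (df * g a + f a * dg).
Proof.
move=> hf hg; have -> : df * g a + f a * dg = f a *: dg + g a *: df.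
  by rewrite addrC; congr (_ + _); rewrite mulrC.
exact: is_deriveM.
Qed.

Lemma is_derive_bigsum V W m (f : 'I_m -> V -> W) (a v : V) (df : 'I_m -> W) :
  (forall i, is_derive a v (f i) (df i)) ->
  is_derive a v (fun y => \sum_i f i y) (\sum_i df i).
Proof. by move=> h; rewrite -fct_sumE; exact: is_derive_sum. Qed.

Lemma is_derive_dotv V m (f g : V -> 'rV[R]_m) (a v : V) (df dg : 'rV[R]_m) :
  is_derive a v f df -> is_derive a v g dg ->
  is_derive a v (fun y => dotv (f y) (g y)) (dotv df (g a) + dotv (f a) dg).
Proof.
move=> hf hg; rewrite /dotv -big_split/=; apply: is_derive_bigsum => i.
by apply: is_derive_mul; exact: is_derive_coord.
Qed.

Lemma is_derive_scale V m (k : V -> R) (f : V -> 'rV[R]_m) (a v : V) (dk : R)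
    (df : 'rV[R]_m) :
  is_derive a v k dk -> is_derive a v f df ->
  is_derive a v (fun y => k y *: f y) (dk *: f a + k a *: df).
Proof.
move=> hk hf; apply: is_derive_row => j; rewrite !mxE.
rewrite (_ : (fun y => _) = (fun y => k y * f y 0 j)).
  by apply: is_derive_mul => //; exact: is_derive_coord.
by apply/funext => y; rewrite mxE.
Qed.

Lemma is_derive_pair V W W' (f : V -> W) (g : V -> W') (a v : V) (df : W) (dg : W') :
  is_derive a v f df -> is_derive a v g dg ->
  is_derive a v (fun y => (f y, g y)) (df, dg).
Proof.
case=> fd <- [gd <-].
pose F h := (h^-1 *: ((f \o shift a) (h *: v) - f a),
             h^-1 *: ((g \o shift a) (h *: v) - g a)).
have FE : F @ 0^' --> ('D_v f a, 'D_v g a) by exact: cvg_pair.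
by split; [apply/cvg_ex; exists ('D_v f a, 'D_v g a) | apply: cvg_lim].
Qed.

Lemma derive_basis W m (f : 'rV[R]_m -> W) (a v : 'rV[R]_m) :
  differentiable f a -> 'D_v f a = \sum_i v 0 i *: 'D_(basis_vec R i) f a.
Proof.
move=> df; rewrite deriveE// [in LHS](row_sum_delta v) linear_sum/=.
by apply: eq_bigr => i _; rewrite linearZ/= deriveE.
Qed.

Lemma smooth_on_differentiable V W (U : set V) (f : V -> W) a :
  smooth_on U f -> U a -> differentiable f a.
Proof. by move=> fU; have [+ _] := fU 1%N; apply. Qed.

Lemma smooth_on_derive V W (U : set V) (f : V -> W) v :
  smooth_on U f -> smooth_on U ('D_v f).
Proof. by move=> fU k; have [_ +] := fU k.+1; apply. Qed.

(** * Symmetry of second derivatives *)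

Lemma differentiable_near_approx V (P : V -> R) (a : V) (e : R) :
  differentiable P a -> 0 < e ->
  \forall k \near (0 : V), `|P (k + a) - P a - 'd P a k| <= e * `|k|.
Proof.
move=> /diff_locallyP [_ /eqaddoP h] e0.
have := h _ e0; apply: filter_app; near=> k; rewrite /= !fctE /=.
by rewrite opprD addrA.
Unshelve. all: by end_near. Qed.

(** Its symmetry in [v] and [w] is what makes the two iterated derivatives limits of a single
    quotient. *)
Let second_difference V (f : V -> R) (a v w : V) (h : R) : R :=
  f (h *: v + (h *: w + a)) - f (h *: v + a) - f (h *: w + a) + f a.

(* The mean value theorem in direction v reduces the second difference to an
   increment of P = 'D_v f, to which the differentiability of P at a applies. *)
Lemma second_difference_cvg V (f P : V -> R) (a v w : V) :
  (\forall y \near a, is_derive y v f (P y)) -> differentiable P a ->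
  (h ^- 2 * second_difference f a v w h) @[h --> 0^'+] --> 'D_w P a.
Proof.
move=> fP dP; rewrite deriveE//; apply/cvgrPdist_le => e e0.
(* All increments below have norm at most [h * C]; the summand 1 keeps [C] positive when [v] and [w]
   vanish. The factor 2 in [e'] shares [e] between two remainders. *)
pose C := `|v| + `|w| + 1; have C0 : 0 < C by rewrite ltr_wpDl// addr_ge0.
pose e' := e / (2 * C); have e'0 : 0 < e' by rewrite divr_gt0// mulr_gt0.
have /nbhs_ballP[d1 /= d10 h1] := differentiable_near_approx dP e'0.
have /nbhs_ballP[d2 /= d20 h2] := fP.
near=> h.
have h0 : 0 < h by near: h; exact: nbhs_right_gt.
have hd1 : h * C < d1.
  by rewrite -ltr_pdivlMr//; near: h; apply: nbhs_right_lt; rewrite divr_gt0.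
have hd2 : h * C < d2.
  by rewrite -ltr_pdivlMr//; near: h; apply: nbhs_right_lt; rewrite divr_gt0.
have bnd t : 0 <= t <= h -> `|t *: v + h *: w| <= h * C /\ `|t *: v| <= h * C.
  move=> /andP[t0 th].
  have tv : `|t *: v| <= h * `|v| by rewrite normrZ ger0_norm// ler_wpM2r.
  have hw : `|h *: w| = h * `|w| by rewrite normrZ gtr0_norm.
  split.
    rewrite (le_trans (ler_normD _ _))// hw (le_trans (lerD tv (lexx _)))//.
    by rewrite -mulrDr ler_pM2l// lerDl.
  by rewrite (le_trans tv)// ler_pM2l// /C -addrA lerDl addr_ge0.
have near2 k : `|k| <= h * C -> is_derive (k + a) v f (P (k + a)).
  move=> kC; apply: h2; rewrite -ball_normE/= opprD addrC subrK normrN.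
  exact: le_lt_trans hd2.
have near1 k : `|k| <= h * C -> `|P (k + a) - P a - 'd P a k| <= e' * (h * C).
  move=> kC; have := h1 k; rewrite -ball_normE/= sub0r normrN.
  move=> /(_ (le_lt_trans kC hd1)) /le_trans; apply.
  by rewrite ler_pM2l.
pose F t := f (t *: v + (h *: w + a)) - f (t *: v + a).
have dF t : 0 <= t <= h -> is_derive t 1 F (P (t *: v + (h *: w + a)) - P (t *: v + a)).
  move=> /bnd[b1 b2]; apply: is_deriveB; apply: is_derive_line.
    by rewrite addrA; exact: near2.
  exact: near2.
have [|F_cont|xi] := @MVT R F (fun t => P (t *: v + (h *: w + a)) - P (t *: v + a)) 0 h h0.
- by move=> t; rewrite in_itv/= => /andP[/ltW ? /ltW ?]; apply: dF; apply/andP.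
- apply: derivable_within_continuous => t; rewrite in_itv/= => tI.
  by have [] := dF _ tI.
rewrite in_itv/= subr0 => /andP[/ltW xi0 /ltW xih] Fh.
have -> : second_difference f a v w h = F h - F 0.
  by rewrite /second_difference /F scale0r !add0r; ring.
have /bnd[b1 b2] : 0 <= xi <= h by apply/andP.
have := near1 _ b1; have := near1 _ b2.
have -> : 'd P a (xi *: v + h *: w) = xi * 'd P a v + h * 'd P a w.
  by rewrite linearD; congr (_ + _); exact: linearZ.
have -> : 'd P a (xi *: v) = xi * 'd P a v by exact: linearZ.
rewrite Fh addrA.
set p1 := P (_ *: _ + a); set p2 := P (_ + a); set p0 := P a.
set d := 'd P a w; set dv := xi * _ => H1 H2.
have -> : d - h ^- 2 * ((p2 - p1) * h) = (h * d - (p2 - p1)) / h by field; rewrite gt_eqF.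
rewrite normrM normfV (gtr0_norm h0) ler_pdivrMr//.
have -> : e * h = e' * (h * C) + e' * (h * C) by rewrite /e'; field; rewrite gt_eqF.
(* The error is the difference of the first-order remainders of [P] at [xi *: v + a] and at
   [xi *: v + h *: w + a]; the common term [dv] cancels. *)
rewrite (_ : _ - _ = (p1 - p0 - dv) - (p2 - p0 - (dv + h * d))); last by ring.
by apply: (le_trans (ler_normB _ _)); exact: lerD.
Unshelve. all: by end_near. Qed.

(** Schwarz's theorem in Young's form: both sides are the right-hand limit of the second difference
    divided by [h ^+ 2], and limits are unique. *)
Lemma derive_comm V (f P Q : V -> R) (a v w : V) :
  (\forall y \near a, is_derive y v f (P y)) ->
  (\forall y \near a, is_derive y w f (Q y)) ->
  differentiable P a -> differentiable Q a -> 'D_w P a = 'D_v Q a.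
Proof.
move=> fP fQ dP dQ.
have cP := @second_difference_cvg _ f P a v w fP dP.
have cQ := @second_difference_cvg _ f Q a w v fQ dQ.
have E : second_difference f a v w = second_difference f a w v.
  apply/funext => h; rewrite /second_difference.
  by rewrite [h *: v + (_ + _)]addrCA; ring.
rewrite E in cP; exact: cvg_unique cP cQ.
Qed.

Lemma derive_comm_row V m (f : V -> 'rV[R]_m) (a v w : V) :
  (\forall y \near a, differentiable f y) ->
  differentiable ('D_v f) a -> differentiable ('D_w f) a ->
  'D_w ('D_v f) a = 'D_v ('D_w f) a.
Proof.
move=> df dv dw; apply/rowP => j.
have coord u u' : differentiable ('D_u f) a ->
    ('D_u' ('D_u f) a) 0 j = 'D_u' (fun y => 'D_u f y 0 j) a.
  by move=> du; rewrite derive_mx ?mxE//; exact: diff_derivable.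
have near_coord u : \forall y \near a,
    is_derive y u (fun y => f y 0 j) ('D_u f y 0 j).
  near=> y; apply: is_derive_coord; apply/derivableP/diff_derivable.
  by near: y.
have diff_coord u : differentiable ('D_u f) a ->
    differentiable (fun y => 'D_u f y 0 j) a.
  move=> du; have := differentiable_coord ('D_u f a) 0 j.
  by move=> /(differentiable_comp du).
apply: (etrans (coord v w dv)); apply: (etrans _ (esym (coord w v dw))).
apply: (derive_comm (near_coord v) (near_coord w)); exact: diff_coord.
Unshelve. all: by end_near. Qed.

End DirectionalDerivatives.

(** * The dot product, Gram matrices and orthogonal hyperplanes *)

Section DotProduct.
Variables (R : realType) (m : nat).
Implicit Types u v w : 'rV[R]_m.

Lemma dotvE u v : dotv u v = (u *m v^T) 0 0.
Proof. by rewrite /dotv mxE; apply: eq_bigr => i _; rewrite !mxE. Qed.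

Lemma dotvC u v : dotv u v = dotv v u.
Proof. by rewrite /dotv; apply: eq_bigr => i _; rewrite mulrC. Qed.

Lemma dotvDl u v w : dotv (u + v) w = dotv u w + dotv v w.
Proof. by rewrite !dotvE mulmxDl mxE. Qed.

Lemma dotvDr u v w : dotv u (v + w) = dotv u v + dotv u w.
Proof. by rewrite dotvC dotvDl !(dotvC u). Qed.

Lemma dotvZl (k : R) u v : dotv (k *: u) v = k * dotv u v.
Proof. by rewrite !dotvE -scalemxAl mxE. Qed.

Lemma dotvZr (k : R) u v : dotv u (k *: v) = k * dotv u v.
Proof. by rewrite dotvC dotvZl dotvC. Qed.

Lemma dotv_suml I (r : seq I) (F : I -> 'rV[R]_m) u :
  dotv (\sum_(i <- r) F i) u = \sum_(i <- r) dotv (F i) u.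
Proof.
rewrite dotvE mulmx_suml summxE; apply: eq_bigr => i _.
by rewrite dotvE.
Qed.

Lemma dotv_sumr I (r : seq I) (F : I -> 'rV[R]_m) u :
  dotv u (\sum_(i <- r) F i) = \sum_(i <- r) dotv u (F i).
Proof. by rewrite dotvC dotv_suml; apply: eq_bigr => i _; rewrite dotvC. Qed.

Lemma dotv_eq0 u : dotv u u = 0 -> u = 0.
Proof.
move=> /eqP; rewrite /dotv psumr_eq0; last by move=> i _; rewrite -expr2 sqr_ge0.
move=> /allP u0; apply/rowP => i; rewrite mxE.
by have := u0 i (mem_index_enum _); rewrite /= mulf_eq0 orbb => /eqP.
Qed.

(** If [v] is in the kernel of the Gram matrix, then [v *m J] has square norm 0. Applied below to
    the first fundamental form and to the metric of a chart. *)
Lemma gram_unitmx k (J : 'M[R]_(k, m)) : row_free J -> J *m J^T \in unitmx.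
Proof.
move=> Jfree; rewrite -row_free_unit; apply: inj_row_free => v vJJ.
have /dotv_eq0 vJ : dotv (v *m J) (v *m J) = 0.
  by rewrite dotvE trmx_mul !mulmxA -(mulmxA v) vJJ mul0mx mxE.
by apply: (row_free_inj Jfree); rewrite vJ mul0mx.
Qed.

(* For dimension reasons the rows of J span the hyperplane orthogonal to y. *)
Lemma tangent_projK (k : nat) (J : 'M[R]_(k, m)) (K : 'M[R]_(m, k)) (y n : 'rV[R]_m) :
  m = k.+1 -> J *m K = 1%:M -> y != 0 -> J *m y^T = 0 -> n *m y^T = 0 ->
  n *m K *m J = n.
Proof.
move=> mk JK y0 Jy ny.
have ryT : \rank y^T = 1%N by rewrite mxrank_tr; apply/eqP; rewrite rank_rV y0.
have rJ : \rank J = k by apply/eqP/row_freeP; exists K.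
have /sub_kermxP Jker := Jy; have /sub_kermxP nker := ny.
have /eqmxP kerE : (J == kermx y^T)%MS.
  by rewrite -(geq_leqif (mxrank_leqif_eq Jker)) mxrank_ker ryT rJ mk subn1.
move: nker; rewrite -kerE => /submxP[w ->].
by rewrite -(mulmxA w) JK mulmx1.
Qed.

End DotProduct.

(** * The Koszul formula for a conformal multiple of a pulled-back metric *)

Section Christoffel.
Variable R : realType.
Implicit Types U V X : 'rV[R]_3.

(** Pairing with [U] lowers the upper index: [g z] cancels the inverse metric inside the Christoffel
    symbol. *)
Lemma gform_christoffel (g : 'rV[R]_3 -> 'M[R]_3) (z U V X : 'rV[R]_3) :
  g z \in unitmx ->
  gform g z U (\row_k \sum_i \sum_j christoffel g z k i j * V 0 i * X 0 j) =
  2^-1 * \sum_l \sum_i \sum_j U 0 l * V 0 i * X 0 j *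
    (pderiv (fun w => g w j l) i z + pderiv (fun w => g w i l) j z
     - pderiv (fun w => g w i j) l z).
Proof.
move=> gz.
(* Twice the Christoffel symbols of the first kind, stored as a column so that the cancellation is
   one of matrices. *)
pose c i j : 'cV[R]_3 := \col_l (pderiv (fun w => g w j l) i z +
  pderiv (fun w => g w i l) j z - pderiv (fun w => g w i j) l z).
have cE i j l : \sum_k g z l k * christoffel g z k i j = 2^-1 * c i j l 0.
  have -> : c i j = g z *m (invmx (g z) *m c i j) by rewrite mulKVmx.
  rewrite [RHS]mulrC mxE mulr_suml; apply: eq_bigr => k _.
  rewrite -mulrA; congr (_ * _); rewrite /christoffel mulrC mxE; congr (_ * _).
  by apply: eq_bigr => l' _; rewrite mxE.
rewrite /gform mulr_sumr; apply: eq_bigr => l _.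
transitivity (\sum_k \sum_i \sum_j
    U 0 l * V 0 i * X 0 j * (g z l k * christoffel g z k i j)).
  apply: eq_bigr => k _; rewrite mxE mulr_sumr; apply: eq_bigr => i _.
  by rewrite mulr_sumr; apply: eq_bigr => j _; ring.
rewrite exchange_big/= mulr_sumr; apply: eq_bigr => i _.
rewrite exchange_big/= mulr_sumr; apply: eq_bigr => j _.
by rewrite -mulr_sumr cE mxE; ring.
Qed.

(* F i and H i j stand for the first and second partial derivatives of a chart. *)
Variables (m : nat) (F : 'I_3 -> 'rV[R]_3 -> 'rV[R]_m) (L : 'rV[R]_3 -> R).
Variables (g : 'rV[R]_3 -> 'M[R]_3) (z : 'rV[R]_3).
Hypothesis gE : forall w, g w = \matrix_(i, j) (L w ^+ 2 * dotv (F i w) (F j w)).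

Lemma gform_conformal U V u v :
  \sum_i U 0 i *: F i z = u -> \sum_i V 0 i *: F i z = v ->
  gform g z U V = L z ^+ 2 * dotv u v.
Proof.
move=> <- <-; rewrite dotv_suml mulr_sumr; apply: eq_bigr => i _.
rewrite dotv_sumr mulr_sumr; apply: eq_bigr => j _.
by rewrite gE mxE dotvZl dotvZr; ring.
Qed.

Variables (H : 'I_3 -> 'I_3 -> 'rV[R]_m).
Hypothesis dF : forall i j, is_derive z (basis_vec R i) (F j) (H i j).
Hypothesis dL : differentiable L z.
Hypothesis Hsym : forall i j, H i j = H j i.

Let l i := 'D_(basis_vec R i) L z.

Let pderiv_conformal i j k : pderiv (fun w => g w j k) i z =
  2 * L z * l i * dotv (F j z) (F k z)
  + L z ^+ 2 * (dotv (H i j) (F k z) + dotv (F j z) (H i k)).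
Proof.
rewrite /pderiv.
have -> : (fun w => g w j k) = (fun w => (L w * L w) * dotv (F j w) (F k w)).
  by apply/funext => w; rewrite gE mxE expr2.
have dLi : is_derive z (basis_vec R i) L (l i) by exact/derivableP/diff_derivable.
have [_ ->] := is_derive_mul (is_derive_mul dLi dLi)
  (is_derive_dotv (dF i j) (dF i k)).
by ring.
Qed.

(** Both sides are trilinear in [U], [V], [X], so it is enough to compare coefficients. The images
    in the ambient space enter through equations, to be replaced later by vectors attached to the
    surface. *)
Lemma gform_christoffel_conformal U V X u v w h : g z \in unitmx ->
  \sum_i U 0 i *: F i z = u -> \sum_i V 0 i *: F i z = v ->
  \sum_i X 0 i *: F i z = w -> \sum_i \sum_j (V 0 i * X 0 j) *: H i j = h ->
  gform g z U (\row_k \sum_i \sum_j christoffel g z k i j * V 0 i * X 0 j) =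
  L z ^+ 2 * dotv u h
  + L z * ('D_V L z * dotv u w + 'D_X L z * dotv u v - 'D_U L z * dotv v w).
Proof.
move=> gz <- <- <- <-; rewrite gform_christoffel//.
pose frame (Y : 'rV[R]_3) : 'rV[R]_m := \sum_i Y 0 i *: F i z.
pose dl (Y : 'rV[R]_3) : R := \sum_i Y 0 i * l i.
have dlE Y : 'D_Y L z = dl Y by rewrite derive_basis.
pose E i := F i z.
(* By symmetry of [H], four of the six second-derivative terms cancel in pairs and the other two
   agree, which absorbs the factor 1/2. *)
have term k i j : 2^-1 * (pderiv (fun w => g w j k) i z +
    pderiv (fun w => g w i k) j z - pderiv (fun w => g w i j) k z) =
    L z ^+ 2 * dotv (E k) (H i j) + L z * (l i * dotv (E k) (E j)
      + l j * dotv (E k) (E i) - l k * dotv (E i) (E j)).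
  rewrite !pderiv_conformal (Hsym j i) (Hsym k i) (Hsym k j).
  rewrite (dotvC (H i j) (F k z)) (dotvC (H i k) (F j z)).
  rewrite (dotvC (F j z) (F k z)) (dotvC (F i z) (F k z)) /E.
  by move: l => l0; field.
(* Contraction of an array of coefficients with [U], [V], [X]. Each piece of the right-hand side is
   such a contraction, and [term] then compares the arrays. *)
pose S F := \sum_k \sum_i \sum_j U 0 k * V 0 i * X 0 j * F k i j : R.
have SH : dotv (frame U) (\sum_i \sum_j (V 0 i * X 0 j) *: H i j) =
    S (fun k i j => dotv (E k) (H i j)).
  rewrite dotv_suml; apply: eq_bigr => k _; rewrite dotvZl dotv_sumr mulr_sumr.
  apply: eq_bigr => i _; rewrite dotv_sumr mulr_sumr.
  by apply: eq_bigr => j _; rewrite dotvZr; ring.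
have SV : dl V * dotv (frame U) (frame X) = S (fun k i j => l i * dotv (E k) (E j)).
  rewrite dotv_suml mulr_sumr; apply: eq_bigr => k _; rewrite dotvZl dotv_sumr.
  rewrite mulr_suml; apply: eq_bigr => i _; rewrite !mulr_sumr.
  by apply: eq_bigr => j _; rewrite dotvZr; ring.
have SX : dl X * dotv (frame U) (frame V) = S (fun k i j => l j * dotv (E k) (E i)).
  rewrite dotv_suml mulr_sumr; apply: eq_bigr => k _; rewrite dotvZl dotv_sumr.
  rewrite !mulr_sumr; apply: eq_bigr => i _; rewrite mulr_suml.
  by apply: eq_bigr => j _; rewrite dotvZr; ring.
have SU : dl U * dotv (frame V) (frame X) = S (fun k i j => l k * dotv (E i) (E j)).
  rewrite mulr_suml; apply: eq_bigr => k _; rewrite dotv_suml mulr_sumr.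
  apply: eq_bigr => i _; rewrite dotvZl dotv_sumr !mulr_sumr.
  by apply: eq_bigr => j _; rewrite dotvZr; ring.
rewrite !dlE -/(frame U) -/(frame V) -/(frame X) SH SV SX SU /S.
rewrite -big_split -sumrB !mulr_sumr -big_split/=; apply: eq_bigr => k _.
rewrite -big_split -sumrB !mulr_sumr -big_split/=; apply: eq_bigr => i _.
rewrite -big_split -sumrB !mulr_sumr -big_split/=; apply: eq_bigr => j _.
by rewrite mulrCA term; move: l => l0; ring.
Qed.

End Christoffel.

(** * Differentials of the charts of the sphere *)

Section SphereAtlas.
Variables (R : realType) (A : sphere_atlas R) (q y : 'rV[R]_4).
Hypotheses (Sq : S3 q) (qy : snbhd A q y) (Sy : S3 y).

Let z := scoord A q y.

Let zq : sdom A q z. Proof. by have [] := scoordP Sq qy Sy. Qed.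

Let parz : spar A q z = y. Proof. by have [] := scoordP Sq qy Sy. Qed.

Let near_z : \forall w \near z, sdom A q w.
Proof. by apply: open_nbhs_nbhs; split => //; exact: sdom_open. Qed.

Let dpar : differentiable (spar A q) z.
Proof. exact: smooth_on_differentiable (spar_smooth A Sq) zq. Qed.

Let dcoord : differentiable (scoord A q) y.
Proof. exact: smooth_on_differentiable (scoord_smooth A Sq) qy. Qed.

(** Differentiate [scoord A q \o spar A q], which is the identity near [z]. Vectors are rows, so the
    Jacobian of the inner map stands on the left. *)
Lemma jacobian_spar_scoord :
  jacobian (spar A q) z *m jacobian (scoord A q) y = 1%:M.
Proof.
apply/row_matrixP => i; rewrite !rowE mulmx1 mulmxA -deriveEjacobian//.
rewrite -deriveEjacobian// -[in RHS](derive_id z (delta_mx 0 i)).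
rewrite -[in LHS]parz.
have [|_ <-] := @is_derive_comp R _ _ _ (spar A q) (scoord A q) z (delta_mx 0 i) dpar.
  by rewrite parz.
by apply: near_eq_derive; apply: filterS near_z => w /(sparP Sq)[].
Qed.

Lemma row_free_jacobian_spar : row_free (jacobian (spar A q) z).
Proof. by apply/row_freeP; exists (jacobian (scoord A q) y); exact: jacobian_spar_scoord. Qed.

(** Differentiate the constant square norm of [spar A q]: tangent vectors are orthogonal to the
    position vector [y]. *)
Lemma jacobian_spar_orthogonal : jacobian (spar A q) z *m y^T = 0.
Proof.
apply/row_matrixP => i; rewrite rowE mulmxA -deriveEjacobian// row0.
set v := delta_mx 0 i.
have hpar : is_derive z v (spar A q) ('D_v (spar A q) z) by exact/derivableP/diff_derivable.
have [_] := is_derive_dotv hpar hpar.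
have -> : 'D_v (fun w => dotv (spar A q w) (spar A q w)) z = 0.
  rewrite -(@derive_cst R _ _ (1 : R^o) z v); apply: near_eq_derive.
  by apply: filterS near_z => w /(sparP Sq)[].
rewrite parz (dotvC y) => /esym/eqP; rewrite -mulr2n mulrn_eq0/= => /eqP h.
by apply/rowP => j; rewrite ord1 -dotvE h mxE.
Qed.

(** [spar A q \o scoord A q] is known to be the identity on the sphere only, so for tangent [n] the
    chain rule in the ambient space is replaced by the dimension count of [tangent_projK]. *)
Lemma derive_spar_scoord (n : 'rV[R]_4) : dotv n y = 0 ->
  'D_('D_n (scoord A q) y) (spar A q) z = n.
Proof.
move=> ny; rewrite !deriveEjacobian//.
apply: (@tangent_projK _ _ _ _ _ y) => //.
- exact: jacobian_spar_scoord.
- by apply/eqP => y0; move: Sy; rewrite /S3/= y0 dotvE mul0mx mxE => /eqP; rewrite eq_sym oner_eq0.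
- exact: jacobian_spar_orthogonal.
- by apply/rowP => j; rewrite ord1 -dotvE ny mxE.
Qed.

End SphereAtlas.

Lemma gformDr (R : realType) (g : 'rV[R]_3 -> 'M[R]_3) z a b c :
  gform g z a (b + c) = gform g z a b + gform g z a c.
Proof.
rewrite /gform -big_split; apply: eq_bigr => i _ /=.
by rewrite -big_split; apply: eq_bigr => j _ /=; rewrite mxE mulrDr.
Qed.

(** * The surface and its normal, read in a fixed chart of the sphere *)

Section ConformalMeanCurvature.
Variables (R : realType) (M : surface R) (x n : M -> 'rV[R]_4).
Variables (A : sphere_atlas R) (lambda : 'rV[R]_4 -> R).
Hypotheses (hx : immersed_in_S3 x) (hn : unit_normal x n).
Hypothesis hlambda : smooth_on_S3 A (lambda : 'rV[R]_4 -> R^o).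
Hypothesis lambda_gt0 : forall y, S3 y -> 0 < lambda y.
Variable p : M.

Local Notation q := (x p).
Local Notation s0 := (chart p p).
Local Notation phi := (spar A q).
Local Notation kappa := (scoord A q).
Local Notation z0 := (kappa q).
Local Notation L := (lambda \o phi).
Local Notation e i := (basis_vec R i).

Let Sx m : S3 (x m). Proof. by case: hx. Qed.

Let param_chart : param p s0 = p.
Proof. by apply: chartK; exact: dom_mem. Qed.

Let chart_mem : (chart p @` dom p) s0.
Proof. by exists p => //; exact: dom_mem. Qed.

Let dx : differentiable (x \o param p) s0.
Proof. by have [/(_ p) /smooth_on_differentiable + _ _] := hx; exact. Qed.

Let dn : differentiable (n \o param p) s0.
Proof. by have [/(_ p) /smooth_on_differentiable + _ _ _] := hn; exact. Qed.

Let nbhs_mem : snbhd A q q. Proof. exact: snbhd_mem. Qed.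

Let sdom_z0 : sdom A q z0.
Proof. by have [] := scoordP (Sx p) nbhs_mem (Sx p). Qed.

Let phi_z0 : phi z0 = q.
Proof. by have [] := scoordP (Sx p) nbhs_mem (Sx p). Qed.

Let L_z0 : L z0 = lambda q. Proof. by rewrite /= phi_z0. Qed.

Let lambda_q : 0 < lambda q. Proof. exact: lambda_gt0. Qed.

Let dL : differentiable L z0.
Proof. exact: smooth_on_differentiable (hlambda (Sx p)) sdom_z0. Qed.

Let near_phi : \forall z \near z0, differentiable phi z.
Proof.
have : nbhs z0 (sdom A q) by apply: open_nbhs_nbhs; split => //; exact: sdom_open.
by apply: filterS => z /(smooth_on_differentiable (spar_smooth A (Sx p))).
Qed.

Let dphi : differentiable phi z0. Proof. exact: nbhs_singleton near_phi. Qed.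

Let ddphi v : differentiable ('D_v phi) z0.
Proof.
exact: smooth_on_differentiable (smooth_on_derive v (spar_smooth A (Sx p))) sdom_z0.
Qed.

Let dkappa : differentiable kappa q.
Proof. exact: smooth_on_differentiable (scoord_smooth A (Sx p)) nbhs_mem. Qed.

Let ddkappa v : differentiable ('D_v kappa) q.
Proof.
exact: smooth_on_differentiable (smooth_on_derive v (scoord_smooth A (Sx p))) nbhs_mem.
Qed.

(** The chart of index [q] stays fixed while the surface point moves. Identities read through it
    therefore hold near [s0], which is enough to differentiate them there. *)
Let near_snbhd : \forall s \near s0, snbhd A q (x (param p s)).
Proof.
have cx : (x \o param p) s @[s --> s0] --> (x \o param p) s0.
  exact: differentiable_continuous.
apply: cx; rewrite /= param_chart; apply: open_nbhs_nbhs; split => //.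
exact: snbhd_open.
Qed.

Let dxE : x (param p s0) = q. Proof. by rewrite param_chart. Qed.

Let n_orth : dotv (n p) q = 0. Proof. by case: hn. Qed.

Let n_dx v : dotv (n p) (dmap x p v) = 0. Proof. by case: hn. Qed.

(** The normal derivative of [lambda]; it enters [cone_normalE] and [conformal_mean_curvatureE] with
    opposite signs. *)
Let dlambda_n : R := dS3 A (lambda : 'rV[R]_4 -> R^o) q (n p).

Let du : differentiable (kappa \o (x \o param p)) s0.
Proof.
have h : differentiable kappa ((x \o param p) s0) by rewrite /= param_chart.
exact: differentiable_comp dx h.
Qed.

(** Since [x] takes values in the sphere, [phi \o kappa \o x] agrees with [x] near [p]; the chain
    rule does the rest. *)
Lemma derive_phi_du v : 'D_(dmap (surface_coord A x q) p v) phi z0 = dmap x p v.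
Proof.
have E : (kappa \o (x \o param p)) s0 = z0 by rewrite /= param_chart.
have [|_] := @is_derive_comp R _ _ _ (kappa \o (x \o param p)) phi s0 v du.
  by rewrite E.
rewrite E => <-; apply: near_eq_derive; apply: filterS near_snbhd => s sq /=.
by have [] := scoordP (Sx p) sq (Sx _).
Qed.

Let phi_du v :
  \sum_i dmap (surface_coord A x q) p v 0 i *: 'D_(e i) phi z0 = dmap x p v.
Proof. by rewrite -derive_basis// derive_phi_du. Qed.

Lemma derive_phi_normal : 'D_(normal_coord A lambda x n q p) phi z0 =
  (lambda q)^-1 *: n p.
Proof.
by apply: derive_spar_scoord => //; rewrite dotvZl n_orth mulr0.
Qed.

Lemma derive_lambda_normal :
  'D_(normal_coord A lambda x n q p) L z0 = (lambda q)^-1 * dlambda_n.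
Proof.
rewrite /normal_coord /dlambda_n /dS3 !(deriveE _ dkappa) !(deriveE _ dL).
by rewrite !linearZ.
Qed.

Lemma cone_normalE :
  cone_normal A lambda x n p =
  ((lambda q)^-1 * dlambda_n) *: ((1, q) : mink_space R) + (0, n p).
Proof.
have w : dS3 A (cone_embedding lambda) q (n p) =
    dlambda_n *: ((1, q) : mink_space R) + lambda q *: (0, n p).
  rewrite /dS3; set v := 'D_(n p) kappa q.
  have hL : is_derive z0 v (L : _ -> R^o) dlambda_n by exact/derivableP/diff_derivable.
  have hphi : is_derive z0 v phi (n p).
    have <- : 'D_v phi z0 = n p by exact: derive_spar_scoord.
    exact/derivableP/diff_derivable.
  have [_] := is_derive_pair hL (is_derive_scale hL hphi).
  have -> : (fun y => (L y, L y *: phi y)) = cone_embedding lambda \o phi.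
    by apply/funext => y; rewrite /cone_embedding; congr pair; rewrite /= [RHS]mulr1.
  move=> ->; rewrite phi_z0 L_z0.
  by congr pair; rewrite /= ?[_ *: 1]mulr1 ?scaler0 ?addr0.
rewrite /cone_normal w.
(* The vector [(1, q)] is null and orthogonal to [(0, n p)], and the latter has norm 1, so only
   [lambda q ^+ 2] survives; its root is [lambda q] by positivity. *)
have -> : mink (dlambda_n *: ((1, q) : mink_space R) + lambda q *: (0, n p))
    (dlambda_n *: ((1, q) : mink_space R) + lambda q *: (0, n p)) = lambda q ^+ 2.
  have nn : dotv (n p) (n p) = 1 by case: hn.
  have qq : dotv q q = 1 by exact: Sx.
  rewrite /mink /= ![_ *: 1]mulr1 !scaler0 !addr0 !dotvDl !dotvDr !dotvZl !dotvZr.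
  by rewrite (dotvC q (n p)) n_orth nn qq; ring.
rewrite sqrtr_sqr gtr0_norm// scalerDr !scalerA.
by rewrite mulVf ?scale1r// gt_eqF.
Qed.

Lemma fundI_unitmx : fundI x p \in unitmx.
Proof.
have -> : fundI x p = jacobian (x \o param p) s0 *m (jacobian (x \o param p) s0)^T.
  apply/matrixP => a b; rewrite [LHS]mxE [RHS]mxE; apply: eq_bigr => i _.
  by rewrite /dmap !deriveEjacobian// -!rowE !mxE.
apply: gram_unitmx; apply: inj_row_free => v; rewrite -deriveEjacobian//.
by have [_ _ /(_ p v)] := hx.
Qed.

(** Smoothness of [lambda] is given only through charts of the sphere, so the function is factored
    as [L] after [kappa \o x] near [s0]. *)
Let derivable_lambda v : derivable (fun s => lambda (x (param p s)) : R^o) s0 v.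
Proof.
apply: (@near_eq_derivable _ _ _ (L \o (kappa \o (x \o param p)))).
  apply: filterS near_snbhd => s sq /=.
  by have [_ ->] := scoordP (Sx p) sq (Sx _).
have h : differentiable L ((kappa \o (x \o param p)) s0) by rewrite /= param_chart.
have := differentiable_comp du h; exact: diff_derivable.
Qed.

Let derivable_lambdaV v :
  derivable (fun s => (lambda (x (param p s)))^-1 : R^o) s0 v.
Proof. by apply: derivableV => //; rewrite dxE gt_eqF. Qed.

Let derivable_normal_coord v :
  derivable (normal_coord A lambda x n q \o param p) s0 v.
Proof.
(* Both the base point and the direction of the derivative of [kappa] vary with [s]. Expanding the
   direction in the standard basis separates the two dependences. *)
apply: (@near_eq_derivable _ _ _ (fun s => \sum_i
    ((lambda (x (param p s)))^-1 * n (param p s) 0 i) *: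
    'D_(e i) kappa (x (param p s)))).
  apply: filterS near_snbhd => s sq /=; rewrite /normal_coord derive_basis.
    by apply: eq_bigr => i _; rewrite mxE.
  exact: smooth_on_differentiable (scoord_smooth A (Sx p)) sq.
have hn' i : derivable (fun s => n (param p s) 0 i) s0 v.
  have h : derivable (n \o param p) s0 v by exact: diff_derivable.
  by have [] := is_derive_coord i (derivableP h).
have hk i : derivable (fun s => 'D_(e i) kappa (x (param p s))) s0 v.
  have h : differentiable ('D_(e i) kappa) ((x \o param p) s0) by rewrite /= param_chart.
  have := differentiable_comp dx h; exact: diff_derivable.
have hs (i : 'I_4) := is_derive_scale (is_derive_mul (derivableP (@derivable_lambdaV v))
  (derivableP (@hn' i))) (derivableP (@hk i)).
by have [] := is_derive_bigsum hs.
Qed.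

(* This is the identity d phi(X) = lambda^-1 n differentiated along the surface;
   c is the derivative of lambda^-1. *)
Lemma derive_frame_normal v : exists c,
  \sum_i dmap (normal_coord A lambda x n q) p v 0 i *: 'D_(e i) phi z0
  + \sum_i \sum_j (dmap (surface_coord A x q) p v 0 i *
      normal_coord A lambda x n q p 0 j) *: 'D_(e i) ('D_(e j) phi) z0
  = c *: n p + (lambda q)^-1 *: dmap n p v.
Proof.
set X := normal_coord A lambda x n q; set u := surface_coord A x q.
exists ('D_v (fun s => (lambda (x (param p s)))^-1 : R^o) s0).
have hX := derivableP (@derivable_normal_coord v).
have E : (kappa \o (x \o param p)) s0 = z0 by rewrite /= param_chart.
have hF i : is_derive s0 v ('D_(e i) phi \o (kappa \o (x \o param p)))
    ('D_(dmap u p v) ('D_(e i) phi) z0).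
  have [|h1 h2] := @is_derive_comp R _ _ _ (kappa \o (x \o param p)) ('D_(e i) phi) s0 v du.
    by rewrite E.
  by rewrite E in h2; exact: DeriveDef h1 h2.
have [hl1 hl2] := is_derive_bigsum (fun i => is_derive_scale (is_derive_coord i hX) (hF i)).
have hnv : is_derive s0 v (n \o param p) (dmap n p v).
  exact/derivableP/diff_derivable.
have [_] := is_derive_scale (derivableP (@derivable_lambdaV v)) hnv.
rewrite /= dxE param_chart => <-.
(* Near [s0] the frame sum equals [lambda^-1 n] by [derive_spar_scoord], so both have the same
   derivative; [hl2] computes that of the frame sum by the product rule. *)
rewrite -(near_eq_derive _ (f := fun y => \sum_i (X \o param p) y 0 i *:
    ('D_(e i) phi \o (kappa \o (x \o param p))) y)).
  rewrite hl2 /= param_chart big_split/=; congr (_ + _).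
  rewrite exchange_big/=; apply: eq_bigr => j _.
  rewrite (derive_basis _ (ddphi _)) scaler_sumr; apply: eq_bigr => i _.
  by rewrite scalerA mulrC.
apply: filterS near_snbhd => s sq /=.
have [zs _] := scoordP (Sx p) sq (Sx _).
rewrite -derive_basis; last exact: smooth_on_differentiable (spar_smooth A (Sx p)) zs.
apply: derive_spar_scoord => //; rewrite dotvZl.
by have [_ _ -> _] := hn; rewrite mulr0.
Qed.

(** * Fundamental forms and mean curvature for the conformal metric *)

Local Notation g := (conformal_metric A lambda q).

Let gE w : g w = \matrix_(i, j) (L w ^+ 2 *
  dotv ('D_(e i) phi w) ('D_(e j) phi w)).
Proof. by []. Qed.

Let g_unitmx : g z0 \in unitmx.
Proof.
have -> : g z0 = lambda q ^+ 2 *: (jacobian phi z0 *m (jacobian phi z0)^T).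
  apply/matrixP => i j; rewrite !mxE phi_z0; congr (_ * _).
  by apply: eq_bigr => k _; rewrite !deriveEjacobian// -!rowE !mxE.
rewrite unitmxZ; last by rewrite unitfE expf_neq0// gt_eqF.
by apply: gram_unitmx; exact: row_free_jacobian_spar.
Qed.

Lemma induced_metricE :
  induced_metric g (surface_coord A x q) p = lambda q ^+ 2 *: fundI x p.
Proof.
apply/matrixP => a b; rewrite !mxE.
by rewrite (gform_conformal gE (phi_du (e a)) (phi_du (e b))) L_z0.
Qed.

Lemma second_formE :
  second_form g (surface_coord A x q) (normal_coord A lambda x n q) p =
  lambda q *: fundII x n p - dlambda_n *: fundI x p.
Proof.
have l0 : lambda q != 0 by rewrite gt_eqF.
have hF i j : is_derive z0 (e i) ('D_(e j) phi) ('D_(e i) ('D_(e j) phi) z0).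
  exact/derivableP/diff_derivable.
have sym i j : 'D_(e i) ('D_(e j) phi) z0 = 'D_(e j) ('D_(e i) phi) z0.
  exact: derive_comm_row.
apply/matrixP => a b; rewrite !mxE.
set U := dmap (surface_coord A x q) p (e a).
set V := dmap (surface_coord A x q) p (e b); set X := normal_coord _ _ _ _ _.
(* The ordinary derivative of the normal is separated from the Christoffel part, to which the Koszul
   formula applies. *)
have -> : covariant_derivative g (surface_coord A x q) X p (e b) =
    dmap X p (e b) + \row_k \sum_i \sum_j christoffel g z0 k i j * V 0 i * X p 0 j.
  by apply/rowP => k; rewrite !mxE.
have [c hc] := derive_frame_normal (e b).
have phiX : \sum_i X p 0 i *: 'D_(e i) phi z0 = (lambda q)^-1 *: n p.
  by rewrite -derive_phi_normal (derive_basis _ dphi).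
rewrite gformDr (gform_conformal gE (phi_du (e a)) erefl).
rewrite (gform_christoffel_conformal gE hF dL sym g_unitmx
  (phi_du (e a)) (phi_du (e b)) phiX erefl).
rewrite derive_lambda_normal L_z0.
move: hc (n_dx (e a)) (n_dx (e b)).
move: (dmap x p (e a)) (dmap x p (e b)) (dmap n p (e b)) => xa xb nb.
set w := \sum_i _; set h := \sum_i _; set dV := derive _ _ _; set dU := derive _ _ _.
(* Pairing [hc] with the tangent vector [xa] removes the unknown multiple [c] of [n p]. In the
   Koszul formula, [na] removes the derivative of [L] along [V] and [nb0] the one along [U]; only
   the normal derivative remains. *)
clearbody w h dV dU => /(congr1 (dotv xa)).
rewrite !dotvDr !dotvZr !(dotvC _ (n p)) => + na nb0.
rewrite na nb0 mulr0 add0r => hc.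
rewrite (_ : dotv xa nb = lambda q * (dotv xa h + dotv xa w)).
  by move: (dotv xa w) (dotv xa h) (dotv xa xb) => t1 t2 t3; field.
by rewrite hc mulrA mulfV// mul1r.
Qed.

Lemma conformal_mean_curvatureE :
  conformal_mean_curvature A lambda x n p =
  (lambda q)^-1 * mean_curvature x n p - (lambda q)^-2 * dlambda_n.
Proof.
have l0 : lambda q != 0 by rewrite gt_eqF.
have Iu := fundI_unitmx.
rewrite /conformal_mean_curvature /mean_curvature /trace_wrt.
rewrite induced_metricE second_formE invmxZ; last first.
  by rewrite unitmxZ// unitfE expf_neq0.
rewrite -scalemxAl mulmxBr -!scalemxAr mulVmx//.
(* The 2 by 2 identity has trace 2, which cancels the factor 1/2 in front of [dlambda_n]. *)
by rewrite mxtraceZ linearB/= !mxtraceZ mxtrace1; field.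
Qed.

End ConformalMeanCurvature.

(** * Independence of the conformal Gauss map from the conformal factor *)

Theorem lemma1p0p1 (R : realType) (M : surface R) (x n : M -> 'rV[R]_4)
    (A : sphere_atlas R) (lambda : 'rV[R]_4 -> R)
    (hx : immersed_in_S3 x) (hn : unit_normal x n)
    (hlambda : smooth_on_S3 A (lambda : 'rV[R]_4 -> R^o))
    (lambda_gt0 : forall y, S3 y -> 0 < lambda y) :
  forall p : M,
    conformal_gauss_map x n p =
    conformal_mean_curvature A lambda x n p *: cone_surface lambda x p
      + cone_normal A lambda x n p.
Proof.
move=> p.
have l0 : lambda (x p) != 0.
  by rewrite gt_eqF// lambda_gt0//; case: hx => _ + _; apply.
rewrite (conformal_mean_curvatureE hx hn hlambda lambda_gt0).
rewrite (cone_normalE hx hn hlambda lambda_gt0).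
rewrite /conformal_gauss_map /cone_surface /cone_embedding addrA scalerA -scalerDl.
congr (_ *: _ + _).
(* The coefficient of [(1, x p)]: multiplying the conformal mean curvature by [lambda] gives [H]
   minus [lambda^-1] times the normal derivative of [lambda], and the cone normal restores the
   latter. *)
by field.
Qed.
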